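(* Let $(M,K)$ be a Cartan space, let $k<0$ be a constant and let $c>0$ satisfy $c^2=-\frac1k$. Then $(M,K)$ is a Cartan space of negative constant curvature $k$ if and only if $\wedge^*$ vanishes on $I^*M(c)$, i.e. $\wedge^*_{ij}(x,p)=0$ for all $i,j$ and all $(x,p)\in I^*M(c)$.
   Context: Let $M$ be a real $n$-dimensional smooth manifold with cotangent bundle $\pi^*:T^*M\to M$, local coordinates $(x^i)$ on $M$, induced coordinates $(x^i,p_i)$ on $T^*M$, and $\partial^i:=\partial/\partial p_i$; repeated indices are summed. A Cartan space is a pair $(M,K)$, where $K=K(x,p)$ is a real positive function on $T^*M$, smooth off the zero section and continuous on it, positively $1$-homogeneous in $p$, such that $g^{ij}(x,p)=\frac12\partial^i\partial^jK^2$ is positive definite off the zero section. All objects below live on $T^*M$ with the zero section removed. Let $(g_{ij})=(g^{ij})^{-1}$ and $\{f,h\}=\frac{\partial f}{\partial p_i}\frac{\partial h}{\partial x^i}-\frac{\partial h}{\partial p_i}\frac{\partial f}{\partial x^i}$. The canonical nonlinear connection is $$N_{ij}=\tfrac14\{g_{ij},K^2\}-\tfrac14\Big(g_{ik}\tfrac{\partial^2K^2}{\partial p_k\partial x^j}+g_{jk}\tfrac{\partial^2K^2}{\partial p_k\partial x^i}\Big).$$ Set $\frac{\delta}{\delta x^i}=\frac{\partial}{\partial x^i}+N_{ij}\partial^j$. For $c>0$ let $I^*M(c)=\{(x,p)\in T^*M: K(x,p)=c\}$. Let $R_{ijk}=\frac{\delta N_{jk}}{\delta x^i}-\frac{\delta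 N_{ik}}{\delta x^j}$, $R_{ij}=p_hg^{hk}R_{ikj}$ (symmetric in $i,j$), and let $h_{ij}=g_{ij}-\frac1{K^2}p_ip_j$ be the angular metric. The angular curvature is $\wedge^*_{ij}=R_{ij}+h_{ij}$. The Cartan space $(M,K)$ is of constant curvature $k$ if and only if $R_{ij}=kK^2h_{ij}$ everywhere off the zero section; this criterion (with the sign conventions above) is taken as the definition. *)

(* Defs.v *)
From HB Require Import structures.
From mathcomp Require Import all_boot all_order all_algebra.
From mathcomp Require Import all_classical all_reals all_analysis.
Set Implicit Arguments.
Unset Strict Implicit.
Unset Printing Implicit Defensive.
Import Order.TTheory GRing.Theory Num.Theory numFieldNormedType.Exports.
Local Open Scope classical_set_scope.
Local Open Scope ring_scope.

Section Smooth.
Variables (R : realType) (V W : normedModType R).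

(* Meant for open sets A, where the conditions do not depend on f outside A. *)
Fixpoint Ck (k : nat) (A : set V) (f : V -> W) : Prop :=
  if k is k'.+1 then
    (forall x, A x -> differentiable f x) /\ (forall v, Ck k' A ('D_v f))
  else {within A, continuous f}.

Definition smooth_on (A : set V) (f : V -> W) : Prop := forall k, Ck k A f.

End Smooth.

(* A chart is a homeomorphism from an open set of M onto an open set of R^n; it
   is given by two total functions, whose values off the two open sets are
   irrelevant. *)
Record chart (R : realType) (n : nat) (M : topologicalType) := Chart {
  chart_dom : set M;
  chart_img : set 'rV[R]_n;
  chart_map : M -> 'rV[R]_n;
  chart_inv : 'rV[R]_n -> M;
  chart_dom_open : open chart_dom;
  chart_img_open : open chart_img;
  chart_map_img : forall m, chart_dom m -> chart_img (chart_map m);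
  chart_inv_dom : forall x, chart_img x -> chart_dom (chart_inv x);
  chart_mapK : forall m, chart_dom m -> chart_inv (chart_map m) = m;
  chart_invK : forall x, chart_img x -> chart_map (chart_inv x) = x;
  chart_map_cont : {within chart_dom, continuous chart_map};
  chart_inv_cont : {within chart_img, continuous chart_inv}
}.

Section Transition.
Variables (R : realType) (n : nat) (M : topologicalType).
Implicit Types c d : chart R n M.

Definition transition c d : 'rV[R]_n -> 'rV[R]_n :=
  chart_map d \o chart_inv c.

Definition transition_dom c d : set 'rV[R]_n :=
  chart_img c `&` chart_inv c @^-1` chart_dom d.

Definition compatible c d : Prop :=
  smooth_on (transition_dom c d) (transition c d) /\
  smooth_on (transition_dom d c) (transition d c).

End Transition.

Record smoothManifold (R : realType) (n : nat) := SmoothManifold {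
  points :> topologicalType;
  atlas : set (chart R n points);
  manifold_hausdorff : hausdorff_space points;
  manifold_second_countable : @second_countable points;
  atlas_cover : forall m : points, exists2 c, atlas c & chart_dom c m;
  atlas_compatible : forall c d, atlas c -> atlas d -> compatible c d;
  atlas_maximal : forall c, (forall d, atlas d -> compatible c d) -> atlas c
}.

Section Cotangent.
Variables (R : realType) (n : nat) (M : smoothManifold R n).
Implicit Types (c d e : chart R n M) (m : M) (p q : 'rV[R]_n).

Definition chart_at m c : Prop := atlas c /\ chart_dom c m.

(* p_i = (dy^j/dx^i) q_j, where x are the coordinates of c and y those of d. *)
Definition covector_change c d m q : 'rV[R]_n :=
  \row_i \sum_j
    'D_(delta_mx 0 i) (transition c d) (chart_map c m) 0 j * q 0 j.

Lemma transition_diff c d m : chart_at m c -> chart_at m d ->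
  differentiable (transition c d) (chart_map c m).
Proof.
move=> [ac cm] [ad dm]; have [/(_ 1%N) [+ _] _] := atlas_compatible ac ad.
apply; split; first exact: chart_map_img.
by rewrite /preimage /= chart_mapK.
Qed.

Lemma transition_dom_nbhs c d m : chart_dom c m -> chart_dom d m ->
  nbhs (chart_map c m) (transition_dom c d).
Proof.
move=> cm dm; have ci := chart_map_img cm.
have ni : nbhs (chart_map c m) (chart_img c).
  exact: open_nbhs_nbhs (conj (@chart_img_open _ _ _ c) ci).
apply: filterI => //.
have := @chart_inv_cont _ _ _ c.
rewrite continuous_open_subspace; last exact: chart_img_open.
move=> /(_ (chart_map c m)); rewrite inE => /(_ ci); apply.
rewrite chart_mapK //.
exact: open_nbhs_nbhs (conj (@chart_dom_open _ _ _ d) dm).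
Qed.

Lemma covector_change_jacobian c d m q : chart_at m c -> chart_at m d ->
  covector_change c d m q = q *m ('J (transition c d) (chart_map c m))^T.
Proof.
move=> mc md; apply/rowP => i; rewrite !mxE; apply: eq_bigr => j _.
rewrite deriveEjacobian; last exact: transition_diff.
by rewrite -rowE mulrC !mxE.
Qed.

Lemma covector_change_id c m q : chart_at m c -> covector_change c c m q = q.
Proof.
move=> mc; have [_ cm] := mc; apply/rowP => i; rewrite mxE.
have -> : 'D_(delta_mx 0 i) (transition c c) (chart_map c m)
    = delta_mx 0 i :> 'rV[R]_n.
  rewrite (near_eq_derive (g := id)) ?derive_id //.
  apply: filterS (transition_dom_nbhs cm cm) => x [xc _] /=.
  by rewrite /transition /= chart_invK.
rewrite (bigD1 i) //= mxE !eqxx mul1r big1 ?addr0 // => j /negbTE ji.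
by rewrite mxE ji andbF mul0r.
Qed.

Lemma covector_change_change c d e m q :
  chart_at m c -> chart_at m d -> chart_at m e ->
  covector_change c d m (covector_change d e m q) = covector_change c e m q.
Proof.
move=> mc md me; have [_ cm] := mc; have [_ dm] := md.
have dcd := transition_diff mc md; have dde := transition_diff md me.
have E : transition c d (chart_map c m) = chart_map d m.
  by rewrite /transition /= chart_mapK.
have nE : \forall x \near chart_map c m,
    transition c e x = (transition d e \o transition c d) x.
  apply: filterS (transition_dom_nbhs cm dm) => x [xc xd] /=.
  by rewrite /transition /= chart_mapK.
apply/rowP => i; rewrite mxE [RHS]mxE.
have -> : 'D_(delta_mx 0 i) (transition c e) (chart_map c m)
    = 'D_('D_(delta_mx 0 i) (transition c d) (chart_map c m))
        (transition d e) (chart_map d m).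
  rewrite (near_eq_derive _ nE) deriveE; last first.
    by apply: differentiable_comp => //; rewrite E.
  by rewrite diff_comp ?E // !deriveE.
rewrite [in RHS]deriveEjacobian //.
under [in RHS]eq_bigr => k _ do rewrite mxE mulr_suml.
rewrite exchange_big /=; apply: eq_bigr => j _.
rewrite covector_change_jacobian // mxE mulr_sumr; apply: eq_bigr => k _.
by rewrite mxE mulrA -mulrA [q 0 k * _]mulrC mulrA.
Qed.

(* A point of T^*M: a point of M together with its components in the charts
   around it, which obey the transformation law of covectors.  The components in
   the other charts are set to 0, so that equal covectors are equal records. *)
Record cotangent := Cotangent {
  cot_base : M;
  cot_comp : chart R n M -> 'rV[R]_n;
  cot_comp_change : forall c d, chart_at cot_base c -> chart_at cot_base d ->
    cot_comp c = covector_change c d cot_base (cot_comp d);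
  cot_comp_out : forall c, ~ chart_at cot_base c -> cot_comp c = 0
}.

Definition zero_section : set cotangent :=
  [set xi | forall c, cot_comp xi c = 0].

Definition cot_coord c (xi : cotangent) : 'rV[R]_n * 'rV[R]_n :=
  (chart_map c (cot_base xi), cot_comp xi c).

Definition of_coord_comp c m p d : 'rV[R]_n :=
  if `[< chart_at m c /\ chart_at m d >] then covector_change d c m p else 0.

Lemma of_coord_change c m p d e : chart_at m d -> chart_at m e ->
  of_coord_comp c m p d = covector_change d e m (of_coord_comp c m p e).
Proof.
move=> md me; rewrite /of_coord_comp.
have [mc|nmc] := pselect (chart_at m c).
  by rewrite !asboolT // covector_change_change.
rewrite !asboolF; try by case.
by apply/rowP => i; rewrite !mxE big1 // => j _; rewrite mxE mulr0.
Qed.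

Lemma of_coord_out c m p d : ~ chart_at m d -> of_coord_comp c m p d = 0.
Proof. by move=> md; rewrite /of_coord_comp asboolF // => -[]. Qed.

(* The covector with coordinates z in the chart c. *)
Definition of_coord c (z : 'rV[R]_n * 'rV[R]_n) : cotangent :=
  Cotangent (@of_coord_change c (chart_inv c z.1) z.2)
            (@of_coord_out c (chart_inv c z.1) z.2).

Lemma cotangent_eq (xi eta : cotangent) :
  cot_base xi = cot_base eta -> cot_comp xi = cot_comp eta -> xi = eta.
Proof.
case: xi eta => [m f h1 h2] [m' f' h1' h2'] /= mm' ff'; subst m' f'.
by congr Cotangent; exact: Prop_irrelevance.
Qed.

Lemma cot_coordK c xi : chart_at (cot_base xi) c ->
  of_coord c (cot_coord c xi) = xi.
Proof.
move=> mc; have [_ cm] := mc; apply: cotangent_eq => /=.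
  exact: chart_mapK.
rewrite chart_mapK //; apply/funext => d; rewrite /of_coord_comp.
have [md|nmd] := pselect (chart_at (cot_base xi) d).
  by rewrite asboolT // -cot_comp_change.
by rewrite asboolF ?cot_comp_out // => -[].
Qed.

Lemma of_coordK c z : atlas c -> chart_img c z.1 ->
  cot_coord c (of_coord c z) = z.
Proof.
move=> ac cz; have mc : chart_at (chart_inv c z.1) c.
  by split => //; exact: chart_inv_dom.
rewrite /cot_coord /= chart_invK // /of_coord_comp asboolT //.
by rewrite covector_change_id //; case: z cz mc.
Qed.

Lemma scale_change (a : R) (xi : cotangent) c d :
  chart_at (cot_base xi) c -> chart_at (cot_base xi) d ->
  a *: cot_comp xi c = covector_change c d (cot_base xi) (a *: cot_comp xi d).
Proof.
move=> mc md; rewrite (cot_comp_change mc md); apply/rowP => i.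
by rewrite !mxE mulr_sumr; apply: eq_bigr => j _; rewrite mxE mulrCA.
Qed.

Lemma scale_out (a : R) (xi : cotangent) c :
  ~ chart_at (cot_base xi) c -> a *: cot_comp xi c = 0.
Proof. by move=> mc; rewrite cot_comp_out // scaler0. Qed.

Definition cotangent_scale (a : R) (xi : cotangent) : cotangent :=
  @Cotangent (cot_base xi) (fun c => a *: cot_comp xi c)
    (@scale_change a xi) (@scale_out a xi).

Definition local_expr (K : cotangent -> R) c : 'rV[R]_n * 'rV[R]_n -> R :=
  K \o of_coord c.

End Cotangent.

(* L is the expression of K in a chart and z = (x, p).  With d^i = d/dp_i, the
   functions gup, gdown, nlc, deltax i, curv3, curv2, angular_metric and
   angular_curvature are g^{ij}, g_{ij}, the canonical nonlinear connection
   N_{ij}, delta/delta x^i, R_{ijk}, R_{ij}, h_{ij} and R_{ij} + h_{ij}; dp i is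
   d^i and poisson f h is {f, h} = d^i f d_i h - d^i h d_i f. *)
Section LocalGeometry.
Variables (R : realType) (n : nat).
Local Notation phase := ('rV[R]_n * 'rV[R]_n)%type.
Implicit Types (f h L : phase -> R) (z : phase) (i j k : 'I_n).

Definition dx i f : phase -> R := 'D_((delta_mx 0 i, 0) : phase) f.

Definition dp i f : phase -> R := 'D_((0, delta_mx 0 i) : phase) f.

Definition sq L : phase -> R := fun z => L z ^+ 2.

Definition poisson f h : phase -> R := fun z =>
  \sum_i (dp i f z * dx i h z - dp i h z * dx i f z).

Definition gup L z : 'M[R]_n :=
  \matrix_(i, j) (2^-1 * dp i (dp j (sq L)) z).

Definition gdown L z : 'M[R]_n := invmx (gup L z).

Definition nlc L i j : phase -> R := fun z =>
  4^-1 * poisson (fun y => gdown L y i j) (sq L) z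
  - 4^-1 * \sum_k (gdown L z i k * dp k (dx j (sq L)) z
                   + gdown L z j k * dp k (dx i (sq L)) z).

Definition deltax L i f : phase -> R := fun z =>
  dx i f z + \sum_j nlc L i j z * dp j f z.

Definition curv3 L i j k : phase -> R := fun z =>
  deltax L i (nlc L j k) z - deltax L j (nlc L i k) z.

Definition curv2 L i j : phase -> R := fun z =>
  \sum_h \sum_k z.2 0 h * gup L z h k * curv3 L i k j z.

Definition angular_metric L i j : phase -> R := fun z =>
  gdown L z i j - (L z ^+ 2)^-1 * z.2 0 i * z.2 0 j.

Definition angular_curvature L i j : phase -> R := fun z =>
  curv2 L i j z + angular_metric L i j z.

Definition posdef (A : 'M[R]_n) : Prop :=
  A^T = A /\ forall u : 'rV[R]_n, u != 0 -> 0 < (u *m A *m u^T) 0 0.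

End LocalGeometry.

Section Cartan.
Variables (R : realType) (n : nat) (M : smoothManifold R n).
Implicit Types K : cotangent M -> R.

(* Homogeneity forces K = 0 on the zero section. *)
Record cartan_space K : Prop := {
  cartan_pos : forall xi, ~ zero_section xi -> 0 < K xi;
  cartan_cont : forall c, atlas c ->
    {within chart_img c `*` setT, continuous (local_expr K c)};
  cartan_smooth : forall c, atlas c ->
    smooth_on (chart_img c `*` [set p | p != 0]) (local_expr K c);
  cartan_homogeneous : forall (a : R) xi, 0 < a ->
    K (cotangent_scale a xi) = a * K xi;
  cartan_posdef : forall xi c, ~ zero_section xi -> chart_at (cot_base xi) c ->
    posdef (gup (local_expr K c) (cot_coord c xi))
}.

Definition constant_curvature K (k : R) : Prop :=
  forall xi c, ~ zero_section xi -> chart_at (cot_base xi) c ->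
  forall i j : 'I_n,
    curv2 (local_expr K c) i j (cot_coord c xi)
    = k * K xi ^+ 2 * angular_metric (local_expr K c) i j (cot_coord c xi).

Definition indicatrix K (r : R) : set (cotangent M) := [set xi | K xi = r].

End Cartan.

(* Main.v *)
(* Everything rests on homogeneity in p: N_{ij} and R_{ijk} have degree 1, so
   R_{ij} has degree 2, while h_{ij} has degree 0.  Scaling a nonzero covector xi
   by c / K xi moves it to the indicatrix K = c, where R_{ij} + h_{ij} = 0 becomes
   (c / K xi)^2 R_{ij} + h_{ij} = 0 at xi, that is R_{ij} = k K^2 h_{ij} because
   c^2 = - 1 / k.  Smoothness plays no role: scaling commutes with directional
   derivatives even at points where these do not exist. *)
Require Import Defs.
From mathcomp Require Import all_boot all_order all_algebra.
From mathcomp Require Import all_classical all_reals all_analysis.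
From mathcomp Require Import ring.
Import Order.TTheory GRing.Theory Num.Theory numFieldNormedType.Exports.
Local Open Scope classical_set_scope.
Local Open Scope ring_scope.

(** Multiplication by [a] is a homeomorphism fixing 0. An equality of filters, rather than a
    convergence, lets limits be reparametrised even where they do not exist. *)
Lemma dnbhs0_scale {R : numFieldType} (a : R) : a != 0 ->
  (a * t @[t --> 0^']) = (0 : R)^'.
Proof.
have scale_cvg (b : R) : b != 0 -> b * t @[t --> 0^'] --> (0 : R)^'.
  move=> b0.
  have := @continuous_injective_withinNx _ _ ( *%R b) 0 (@mulrl_continuous _ b 0).
  by rewrite mulr0; apply => y; rewrite -[RHS](mulr0 b) => /(mulfI b0).
move=> a0; apply/seteqP; split => P; last exact: scale_cvg.
(* The remaining inclusion pulls back along multiplication by [a^-1]. *)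
move=> /(scale_cvg _ (invr_neq0 a0)) /=.
rewrite /nbhs /=; apply: (@filterS _ _ (dnbhs_filter _)) => t.
by rewrite /preimage /= mulVKf.
Qed.

(* Also true without convergence: both limits are then the default value 0. *)
Lemma limMl {R : realType} {T : Type} {F : set_system T} {FF : ProperFilter F}
    (b : R) (f : T -> R) : b != 0 ->
  lim (b * f x @[x --> F]) = b * lim (f x @[x --> F]).
Proof.
move=> b0; have [cf|cf] := pselect (cvg (f x @[x --> F])).
  by apply: cvg_lim => //; exact: cvgMl_tmp.
have := @is_cvgMlE_tmp _ _ F _ f b b0; rewrite propeqE => -[bf _].
rewrite (dvgP cf) dvgP; last by move=> /bf.
by rewrite /point /= mulr0.
Qed.

Lemma eq_lim {R : realType} {T : Type} {F : set_system T} (f g : T -> R) :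
  f =1 g -> lim (f x @[x --> F]) = lim (g x @[x --> F]).
Proof. by move=> /funext ->. Qed.

(** The difference quotient along [a *: v] at [t] is [a] times the quotient along [v] at [a * t];
    substitute [a * t] for [t]. *)
Lemma derive_scale {R : realType} {V : normedModType R} (f : V -> R) (x v : V)
    (a : R) : a != 0 -> 'D_(a *: v) f x = a * 'D_v f x.
Proof.
move=> a0; rewrite /derive -limMl//.
rewrite -[in RHS](dnbhs0_scale a a0) -[in RHS]fmap_comp.
apply: eq_lim => t.
rewrite /= scalerA [t * a]mulrC -[_ *: _]/(_ * _) -[in RHS]/(_ * _).
by rewrite mulrA invfM mulVKf.
Qed.

Section Homogeneous.
Context {R : realType} {n : nat}.
Local Notation phase := ('rV[R]_n * 'rV[R]_n)%type.
Implicit Types (f h L : phase -> R) (z : phase) (r s : int) (i j k : 'I_n).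

Definition dilate (a : R) z : phase := (z.1, a *: z.2).

(** The degree is an integer because negative degrees occur, as in [L ^ -2]. *)
Definition homogeneous r f : Prop :=
  forall (a : R) z, 0 < a -> f (dilate a z) = a ^ r * f z.

Lemma homogeneousD r f h : homogeneous r f -> homogeneous r h ->
  homogeneous r (fun z => f z + h z).
Proof. by move=> hf hh a z a0; rewrite hf// hh// mulrDr. Qed.

Lemma homogeneousN r f : homogeneous r f -> homogeneous r (fun z => - f z).
Proof. by move=> hf a z a0; rewrite hf// mulrN. Qed.

Lemma homogeneousB r f h : homogeneous r f -> homogeneous r h ->
  homogeneous r (fun z => f z - h z).
Proof. by move=> hf /homogeneousN; exact: homogeneousD. Qed.

Lemma homogeneousM r s f h : homogeneous r f -> homogeneous s h ->
  homogeneous (r + s) (fun z => f z * h z).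
Proof.
move=> hf hh a z a0.
by rewrite hf// hh// expfzDr ?gt_eqF// mulrACA.
Qed.

Lemma homogeneousMl r (b : R) f : homogeneous r f ->
  homogeneous r (fun z => b * f z).
Proof. by move=> hf a z a0; rewrite hf// mulrCA. Qed.

Lemma homogeneous_sum r (I : finType) (F : I -> phase -> R) :
  (forall i : I, homogeneous r (F i)) ->
  homogeneous r (fun z => \sum_(i : I) F i z).
Proof.
by move=> hF a z a0; rewrite mulr_sumr; apply: eq_bigr => i _; exact: hF.
Qed.

Lemma homogeneous_covector i : homogeneous 1 (fun z => z.2 0 i).
Proof. by move=> a z a0; rewrite /= mxE expr1z. Qed.

(** Dilation is linear, so it maps the line through [z] along [v] to the line through its image
    along [dilate a v]; the factor [a ^ r] leaves the limit. *)
Lemma derive_dilate r f (a : R) z (v : phase) : 0 < a -> homogeneous r f ->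
  'D_(dilate a v) f (dilate a z) = a ^ r * 'D_v f z.
Proof.
move=> a0 hf; rewrite /derive -limMl; last by rewrite expfz_neq0// gt_eqF.
apply: eq_lim => t /=.
have -> : t *: dilate a v + dilate a z = dilate a (t *: v + z).
  by congr pair; rewrite /= scalerDr !scalerA mulrC.
by rewrite !hf// -mulrBr -[_ *: _]/(_ * _) -[in RHS]/(_ * _) mulrCA.
Qed.

(** Dilation fixes the base directions. *)
Lemma homogeneous_dx r f i : homogeneous r f -> homogeneous r (dx i f).
Proof.
move=> hf a z a0; rewrite /dx -(derive_dilate _ _ _ _ _ a0 hf).
by rewrite /dilate /= scaler0.
Qed.

(** Dilation multiplies a fibre direction by [a], which costs one degree. *)
Lemma homogeneous_dp r f i : homogeneous r f -> homogeneous (r - 1) (dp i f).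
Proof.
move=> hf a z a0; have a_neq0 : a != 0 by rewrite gt_eqF.
rewrite expfzDr// exprN1 mulrAC -(derive_dilate _ _ _ _ _ a0 hf).
have -> : dilate a (0, delta_mx 0 i) = a *: ((0, delta_mx 0 i) : phase).
  by congr pair; rewrite /= scaler0.
by rewrite derive_scale// mulrC mulKf.
Qed.

Section Geometry.
Variables (L : phase -> R) (hL : homogeneous 1 L).

Lemma homogeneous_sq : homogeneous 2 (sq L).
Proof. by have := homogeneousM _ _ _ _ hL hL. Qed.

Lemma gup_dilate (a : R) z : 0 < a -> gup L (dilate a z) = gup L z.
Proof.
move=> a0; apply/matrixP => i j; rewrite !mxE; congr (_ * _).
have := homogeneous_dp _ _ i (homogeneous_dp _ _ j homogeneous_sq).
(* The degree [2 - 1 - 1] computes to 0. *)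
by move=> ->//; rewrite mul1r.
Qed.

Lemma homogeneous_gup i j : homogeneous 0 (fun z => gup L z i j).
Proof. by move=> a z a0; rewrite gup_dilate// mul1r. Qed.

Lemma homogeneous_gdown i j : homogeneous 0 (fun z => gdown L z i j).
Proof. by move=> a z a0; rewrite /gdown gup_dilate// mul1r. Qed.

Lemma homogeneous_poisson r s f h : homogeneous r f -> homogeneous s h ->
  homogeneous (r + s - 1) (poisson f h).
Proof.
move=> hf hh; apply: homogeneous_sum => i; apply: homogeneousB.
  rewrite addrAC.
  exact: homogeneousM (homogeneous_dp _ _ i hf) (homogeneous_dx _ _ i hh).
rewrite [r + s]addrC addrAC.
exact: homogeneousM (homogeneous_dp _ _ i hh) (homogeneous_dx _ _ i hf).
Qed.

Lemma homogeneous_nlc i j : homogeneous 1 (nlc L i j).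
Proof.
have hdpdx k l : homogeneous 1 (dp k (dx l (sq L))).
  exact: homogeneous_dp (homogeneous_dx _ _ l homogeneous_sq).
apply: homogeneousB; apply: homogeneousMl.
  exact: homogeneous_poisson (homogeneous_gdown i j) homogeneous_sq.
apply: homogeneous_sum => k; apply: homogeneousD;
  exact: homogeneousM (homogeneous_gdown _ _) (hdpdx _ _).
Qed.

Lemma homogeneous_deltax r i f : homogeneous r f -> homogeneous r (deltax L i f).
Proof.
move=> hf; apply: homogeneousD; first exact: homogeneous_dx.
apply: homogeneous_sum => j; rewrite -[r](subrK 1) addrC.
exact: homogeneousM (homogeneous_nlc i j) (homogeneous_dp _ _ j hf).
Qed.

Lemma homogeneous_curv2 i j : homogeneous 2 (curv2 L i j).
Proof.
apply: homogeneous_sum => h; apply: homogeneous_sum => k.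
apply: (homogeneousM 1 1); last first.
  by apply: homogeneousB; apply/homogeneous_deltax/homogeneous_nlc.
exact: homogeneousM (homogeneous_covector h) (homogeneous_gup h k).
Qed.

Lemma homogeneous_angular_metric i j : homogeneous 0 (angular_metric L i j).
Proof.
apply: homogeneousB; first exact: homogeneous_gdown.
(* The factors [L ^ -2], [p_i] and [p_j] have degrees -2, 1 and 1. *)
apply: (homogeneousM (-1) 1); last exact: homogeneous_covector.
apply: (homogeneousM (-2) 1); last exact: homogeneous_covector.
by move=> a z a0; rewrite hL// expr1z exprMn invfM.
Qed.

End Geometry.
End Homogeneous.

Section Scaling.
Context {R : realType} {n : nat} {M : smoothManifold R n}.
Implicit Types (K : cotangent M -> R) (xi : cotangent M).

Lemma cot_coord_scale (b : R) xi (a : chart R n M) :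
  cot_coord a (cotangent_scale b xi) = dilate b (cot_coord a xi).
Proof. by []. Qed.

(** The change of components is linear in the covector, and the default components 0 are fixed by
    scaling, so [z] may lie outside the chart image. *)
Lemma of_coord_dilate (b : R) (a : chart R n M) z :
  of_coord a (dilate b z) = cotangent_scale b (of_coord a z).
Proof.
apply: cotangent_eq => //=; apply/funext => d; rewrite /of_coord_comp.
case: ifP => _; last by rewrite scaler0.
apply/rowP => i; rewrite !mxE mulr_sumr; apply: eq_bigr => j _.
by rewrite mxE mulrCA.
Qed.

Lemma homogeneous_local_expr K (a : chart R n M) : cartan_space K ->
  homogeneous 1 (local_expr K a).
Proof.
move=> hK b z b0; rewrite /local_expr /= of_coord_dilate expr1z.
exact: cartan_homogeneous.
Qed.

(** A zero covector equals its double, so [K xi = 2 * K xi]. *)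
Lemma cartan_zero_section K xi : cartan_space K -> zero_section xi -> K xi = 0.
Proof.
move=> hK xi0; have : K (cotangent_scale 2 xi) = 2 * K xi.
  exact: cartan_homogeneous.
have -> : cotangent_scale 2 xi = xi.
  by apply: cotangent_eq => //=; apply/funext => d; rewrite xi0 scaler0.
by move/eqP; rewrite mulr_natl mulr2n -subr_eq0 opprD addNKr oppr_eq0 => /eqP.
Qed.

End Scaling.

Theorem theorem4p12 (R : realType) (n : nat) (M : smoothManifold R n)
  (K : cotangent M -> R) (hK : cartan_space K)
  (k : R) (hk : k < 0) (c : R) (hc : 0 < c) (hck : c ^+ 2 = - (1 / k)) :
  constant_curvature K k <->
  (forall xi : cotangent M, indicatrix K c xi ->
   forall a : chart R n M, chart_at (cot_base xi) a ->
   forall i j : 'I_n,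
     angular_curvature (local_expr K a) i j (cot_coord a xi) = 0).
Proof.
have k0 : k != 0 by rewrite lt_eqF.
split=> [ccK xi Kxi a ca i j|angK xi a xi0 ca i j].
  have xi0 : ~ zero_section xi.
    move=> /(cartan_zero_section _ _ hK) K0; move: hc.
    by rewrite -Kxi K0 ltxx.
  (* On the indicatrix, [k * K xi ^+ 2 = k * c ^+ 2 = -1]. *)
  rewrite /angular_curvature ccK// Kxi hck mulrN div1r mulfV//.
  by rewrite mulN1r addNr.
have Kxi := cartan_pos hK xi0.
pose b := c / K xi; have b0 : 0 < b by rewrite divr_gt0.
have hL := homogeneous_local_expr K a hK.
have : indicatrix K c (cotangent_scale b xi).
  by rewrite /indicatrix /= (cartan_homogeneous hK)// divfK// gt_eqF.
move=> /angK /(_ a ca i j); rewrite cot_coord_scale /angular_curvature.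
rewrite (homogeneous_curv2 _ hL)// (homogeneous_angular_metric _ hL)// mul1r.
rewrite -exprnP expr_div_n hck => /eqP; rewrite addr_eq0 => /eqP bR.
(* Eliminating [h_{ij}] through [bR] leaves an identity in [k], [K xi] and [R_{ij}]. *)
rewrite -[angular_metric _ _ _ _]opprK -bR.
by field; rewrite k0 gt_eqF.
Qed.
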